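(* Let $p$ be an odd prime, $m,s$ positive integers, $R=\mathbb F_{p^m}+u\mathbb F_{p^m}$ with $u^2=0$, and let $\sigma$ be a ring automorphism of $R$ with $\sigma^{-1}=\Theta_{\theta,\varepsilon}$, where $\theta\in \mathrm{Aut}(\mathbb F_{p^m})$, $\varepsilon\in\mathbb F_{p^m}^\ast$. Let $\gamma\in\mathbb F_{p^m}^\ast$, let $\gamma_0\in\mathbb F_{p^m}$ be the element with $\gamma_0^{p^s}=\gamma^{-1}$, and assume $\gamma_0=\theta(\gamma_0^{-1})$. Let $$C=\langle(\gamma_0x-1)^i,\ u(\gamma_0x-1)^\omega\rangle\subseteq\mathcal R_\gamma$$ be a $\gamma$-constacyclic code of length $p^s$ over $R$, where $1\le i\le p^s-1$ and $0\le\omega<T$, with $T$ the smallest integer such that $u(\gamma_0x-1)^T\in\langle(\gamma_0x-1)^i\rangle$. Then: (1) $C$ is $\sigma$-self-orthogonal if and only if $\omega+i\ge p^s$; (2) $C$ is $\sigma$-self-dual if and only if $\omega+i=p^s$.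
   Context: $\Theta_{\theta,\varepsilon}:R\to R$ is the ring automorphism $a+ub\mapsto\theta(a)+u\varepsilon\theta(b)$ ($a,b\in\mathbb F_{p^m}$); every ring automorphism of $R$ has this form. $\mathcal R_\gamma=R[x]/\langle x^{p^s}-\gamma\rangle$. A $\gamma$-constacyclic code of length $n$ over $R$ is an $R$-submodule of $R^n$ stable under $(x_0,\dots,x_{n-1})\mapsto(\gamma x_{n-1},x_0,\dots,x_{n-2})$; it is identified with an ideal of $R[x]/\langle x^n-\gamma\rangle$ via $(c_0,\dots,c_{n-1})\mapsto c_0+c_1x+\cdots+c_{n-1}x^{n-1}$. The $\sigma$-dual of $C\subseteq R^n$ is $C^{\perp_\sigma}=\{\mathbf x\in R^n:\sum_{i=0}^{n-1}c_i\sigma(x_i)=0\text{ for all }\mathbf c\in C\}$; $C$ is $\sigma$-self-orthogonal if $C\subseteq C^{\perp_\sigma}$ and $\sigma$-self-dual if $C=C^{\perp_\sigma}$. *)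

(* Defs.v *)
From HB Require Import structures.
From mathcomp Require Import all_boot all_order all_algebra all_field.

Set Implicit Arguments.
Unset Strict Implicit.
Unset Printing Implicit Defensive.

Import GRing.Theory.
Local Open Scope ring_scope.

Definition ideal_gen (A : comNzRingType) (gs : seq A) (x : A) : Prop :=
  exists a : 'I_(size gs) -> A, x = \sum_(k < size gs) a k * gs`_k.

(* [{poly %/ h}] is A[x]/<h> for h monic of positive degree (otherwise the
   library quotients by 'X), so this is A[x]/<x^n - g> provided 0 < n. *)
Notation ambient n g := {poly %/ ('X^n - g%:P)}.

Section ConstacyclicCodes.

Variables (A : finComNzRingType) (n : nat).
Implicit Types (g : A) (c : 'rV[A]_n) (C : {set 'rV[A]_n}).

(* [ord_pred] is cyclic: position 0 of the shifted word reads position n-1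
   of [c]. *)
Definition constashift g c : 'rV[A]_n :=
  \row_i (if i == 0%N :> nat then g * c 0 (ord_pred i) else c 0 (ord_pred i)).

Definition constacyclic g C : Prop :=
  submod_closed C /\ {in C, forall c, constashift g c \in C}.

Definition word_poly g c : ambient n g := in_qpoly ('X^n - g%:P) (rVpoly c).

Definition ideal_of_code g C (I : ambient n g -> Prop) : Prop :=
  forall c, c \in C <-> I (word_poly g c).

Definition sigma_dual (sigma : A -> A) C : {set 'rV[A]_n} :=
  [set x : 'rV[A]_n |
    [forall c : 'rV[A]_n in C, \sum_(i < n) c 0 i * sigma (x 0 i) == 0]].

Definition sigma_self_orthogonal (sigma : A -> A) C : Prop :=
  C \subset sigma_dual sigma C.

Definition sigma_self_dual (sigma : A -> A) C : Prop :=
  C = sigma_dual sigma C.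

Lemma ideal_of_code_constacyclic g C (gs : seq (ambient n g)) :
  (0 < n)%N -> ideal_of_code C (ideal_gen gs) -> constacyclic g C.
Proof.
move=> n_gt0 CI.
have idD x y : ideal_gen gs x -> ideal_gen gs y -> ideal_gen gs (x + y).
  move=> [a ->] [b ->]; exists (fun k => a k + b k).
  by rewrite -big_split; apply: eq_bigr => k _; rewrite mulrDl.
have idM x y : ideal_gen gs y -> ideal_gen gs (x * y).
  move=> [a ->]; exists (fun k => x * a k).
  by rewrite mulr_sumr; apply: eq_bigr => k _; rewrite mulrA.
have wpZ a c : word_poly g (a *: c) = a%:A * word_poly g c.
  by rewrite /word_poly !linearZ /= mulr_algl.
split.
  split.
    apply/CI; exists (fun=> 0); rewrite /word_poly !raddf0 big1 // => k _.
    by rewrite mul0r.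
  move=> a c d /CI cI /CI dI; apply/CI.
  rewrite /word_poly linearD raddfD; apply: idD => //.
  by have := idM a%:A _ cI; rewrite -wpZ.
move=> c /CI cI; apply/CI.
suff -> : word_poly g (constashift g c) = 'qX * word_poly g c by exact: idM.
have [k nE] : exists k, n = k.+1 by exists n.-1; rewrite prednK.
have hm : ('X^n - g%:P : {poly A}) \is monic.
  by rewrite nE monicE lead_coefDl ?lead_coefXn // size_polyN size_polyXn
             (leq_ltn_trans (size_polyC_leq1 _)).
have hs : (1 < size ('X^n - g%:P : {poly A})%R)%N.
  by rewrite size_polyDl size_polyXn ?nE // size_polyN
             (leq_ltn_trans (size_polyC_leq1 _)).
rewrite /word_poly -in_qpolyM.
have c_last (j : nat) (lt_jn : (j < n)%N) : (rVpoly c)`_j = c 0 (Ordinal lt_jn).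
  by rewrite -[RHS]coef_rVpoly_ord.
have -> : rVpoly (constashift g c) =
          'X * rVpoly c - (rVpoly c)`_n.-1 *: ('X^n - g%:P).
  apply/polyP => j; rewrite coefB coefZ coefB coefXn coefC coefXM.
  have [lt_jn|le_nj] := ltnP j n; last first.
    rewrite !coef_rVpoly; case: insubP => [x /=|_]; first by rewrite ltnNge le_nj.
    have j_gt0 : (j == 0)%N = false by rewrite -leqn0 leqNgt (leq_trans n_gt0).
    rewrite j_gt0 subr0; move: le_nj; rewrite leq_eqVlt => /orP[/eqP <-|lt_nj].
      by rewrite eqxx mulr1 subrr.
    rewrite gtn_eqF // mulr0 subr0; case: insubP => // x /=.
    by rewrite ltnNge -ltnS prednK ?(leq_ltn_trans _ lt_nj) // lt_nj.
  rewrite (_ : (rVpoly (constashift g c))`_j = constashift g c 0 (Ordinal lt_jn));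
    last by rewrite -[RHS]coef_rVpoly_ord.
  rewrite mxE /= (ltn_eqF lt_jn) sub0r.
  have le_pn : (n.-1 < n)%N by rewrite prednK.
  case: eqP => [j0|/eqP]; rewrite ?subr0 ?mulrN ?opprK ?mulr0 ?addr0.
    rewrite add0r c_last mulrC; congr (c 0 _ * g); apply: val_inj.
    by rewrite /= j0 add0n modn_small.
  rewrite -lt0n => j_gt0.
  have lt_pj : (j.-1 < n)%N by rewrite (leq_ltn_trans (leq_pred _)).
  rewrite c_last; congr (c 0 _); apply: val_inj => /=.
  by rewrite -(prednK j_gt0) addSn /= modnDr modn_small.
rewrite linearB linearZ /= [X in _ - _ *: X](_ : _ = 0) ?scaler0 ?subr0 //.
apply: val_inj; rewrite /= /mk_monic hs hm /=.
exact: Pdiv.RingMonic.rmodpp.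
Qed.

End ConstacyclicCodes.

Notation dualnum F := {poly %/ ('X^2 : {poly F})}.

Section DualNumbers.

Variable F : finFieldType.

Definition dn_const (a : F) : dualnum F := qpolyC 'X^2 a.

Definition dn_u : dualnum F := qpolyX 'X^2.

Definition Theta (theta : F -> F) (eps : F) (z : dualnum F) : dualnum F :=
  dn_const (theta z`_0) + dn_u * dn_const (eps * theta z`_1).

Lemma dn_uu : dn_u * dn_u = 0.
Proof.
rewrite /dn_u /qpolyX -in_qpolyM -expr2; apply: val_inj => /=.
by rewrite mk_monic_Xn Pdiv.RingMonic.rmodpp // monicXn.
Qed.

Lemma dn_coef (a b : F) :
  (dn_const a + dn_u * dn_const b : dualnum F) = a%:P + b *: 'X :> {poly F}.
Proof.
have sz : (size (mk_monic ('X^2 : {poly F})) = 3)%N.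
  by rewrite mk_monic_Xn size_polyXn.
have -> : dn_u * dn_const b = in_qpoly 'X^2 (b *: 'X).
  rewrite -mul_polyC in_qpolyM mulrC; congr (_ * _); apply: val_inj.
  rewrite [RHS]in_qpoly_small // sz.
  exact: leq_ltn_trans (size_polyC_leq1 _) _.
rewrite poly_of_qpolyD in_qpoly_small // sz.
by rewrite (leq_ltn_trans (size_scale_leq _ _)) ?size_polyX.
Qed.

Lemma dn_decomp (z : dualnum F) : z = dn_const z`_0 + dn_u * dn_const z`_1.
Proof.
apply: val_inj; rewrite [RHS]dn_coef; apply/polyP => i.
rewrite coefD coefC coefZ coefX.
case: i => [|[|i]]; rewrite ?mulr0 ?addr0 ?mulr1 ?add0r //=.
rewrite nth_default //; apply: leq_trans (size_npoly z) _.
by rewrite mk_monic_Xn size_polyXn.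
Qed.

Lemma ThetaE (theta : F -> F) (eps a b : F) :
  Theta theta eps (dn_const a + dn_u * dn_const b) =
  dn_const (theta a) + dn_u * (dn_const eps * dn_const (theta b)).
Proof.
rewrite /Theta dn_coef !coefD !coefC !coefZ !coefX /= mulr0 mulr1 addr0 add0r.
by rewrite /dn_const qpolyCM.
Qed.

End DualNumbers.

(* Main.v *)
(* With f = gamma0 x - 1 one has f^N = 0 for N = p^s, and the ambient ring is
   F[u, f]/(u^2, f^N), whose socle is spanned by u f^(N-1) != 0.  The
   sigma-semilinear involution [star] : c(x) |-> (sigma c)(x^-1) is a ring
   automorphism because sigma gamma = gamma^-1, the form defining the sigma-dual
   is the constant term of c * star x, and [star] maps f and u to unit multiples
   of themselves.  Hence the sigma-dual of C is the annihilator
   <f^(N - omega), u f^(N - i)> of C. *)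

Require Import Defs.
From HB Require Import structures.
From mathcomp Require Import all_boot all_order all_algebra all_field.
Import GRing.Theory.
Local Open Scope ring_scope.

Set Implicit Arguments.
Unset Strict Implicit.
Unset Printing Implicit Defensive.

Lemma ideal_gen2P (A : comNzRingType) (g h y : A) :
  ideal_gen [:: g; h] y <-> exists a b, y = a * g + b * h.
Proof.
split=> [[a ->]|[a [b ->]]].
  by exists (a ord0), (a (lift ord0 ord0)); rewrite big_ord_recl big_ord1.
exists (fun k => if k == 0%N :> nat then a else b).
by rewrite big_ord_recl big_ord1.
Qed.

Lemma ideal_gen_mull {A : comNzRingType} {gs : seq A} (x : A) {y : A} :
  ideal_gen gs y -> ideal_gen gs (x * y).
Proof.
move=> [a ->]; exists (fun k => x * a k).
by rewrite mulr_sumr; apply: eq_bigr => k _; rewrite mulrA.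
Qed.

(** * Ideals and annihilators in a ring with nilpotents [u] and [f] *)

Section TwoNilpotents.

Variables (F : fieldType) (A : comNzRingType) (kappa : {rmorphism F -> A}).
Variables (u f : A) (N : nat).
Hypotheses (uu : u * u = 0) (fN : f ^+ N = 0) (u_top : u * f ^+ N.-1 != 0).
(** One step of an [f]-adic expansion with digits in F + uF, in place of an explicit basis of
    [A]. *)
Hypothesis decomp : forall b : A,
  exists r0 r1 b', b = kappa r0 + u * kappa r1 + f * b'.

Lemma expf_eq0 k : (N <= k)%N -> f ^+ k = 0.
Proof. by move=> /subnK <-; rewrite exprD fN mulr0. Qed.

Lemma nilpotency_index_gt0 : (0 < N)%N.
Proof. by case: N fN => // /eqP; rewrite expr0 oner_eq0. Qed.

(** For k < N, multiplying by [f ^+ (N.-1 - k)] would kill the socle generator [u * f ^+ N.-1]. *)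
Lemma u_expf_eq0 k : u * f ^+ k = 0 -> (N <= k)%N.
Proof.
move=> ufk; rewrite leqNgt; apply: contra u_top => k_lt.
have k_le : (k <= N.-1)%N by rewrite -ltnS prednK ?nilpotency_index_gt0.
by rewrite -(subnK k_le) exprD mulrCA ufk mulr0.
Qed.

Lemma u_top_const r : u * kappa r * f ^+ N.-1 = 0 -> r = 0.
Proof.
move=> ur; apply/eqP; apply: contraNT u_top => r_neq0.
rewrite -[u * _]mulr1 -(rmorph1 kappa) -(divff r_neq0) rmorphM /=.
by rewrite mulrA (mulrAC u) ur mul0r.
Qed.

(* A cofactor not divisible by f modulo u has a nonzero constant term r0, and
   then multiplying down to the socle gives u r0 f^(N-1) != 0. *)
Lemma annihilator_u_expf k y : (k <= N)%N -> u * y * f ^+ (N - k) = 0 ->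
  exists a b, y = a * f ^+ k + u * b.
Proof.
elim: k => [|k IHk] in y * => [_ _|k_lt uy].
  by exists y, 0; rewrite mulr1 mulr0 addr0.
have Nk : (N - k = (N - k.+1).+1)%N by rewrite subnSK.
case: (IHk y) => [|| a [b yE]]; first exact: ltnW.
  by rewrite Nk exprSr mulrA uy mul0r.
have {uy} : u * a * f ^+ N.-1 = 0.
  have -> : N.-1 = (k + (N - k.+1))%N.
    by rewrite -[in LHS](subnKC (ltnW k_lt)) Nk addnS.
  rewrite -[RHS]uy yE exprD mulrDr (mulrA u u) uu mul0r addr0.
  by rewrite -!mulrA.
have [r0 [r1 [a' aE]]] := decomp a.
rewrite {1}aE !mulrDr (mulrA u u) uu mul0r addr0 mulrDl.
rewrite (_ : u * (f * a') * f ^+ N.-1 = 0) ?addr0 => [ur0|]; last first.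
  by rewrite mulrCA mulrAC -exprS prednK ?nilpotency_index_gt0 // fN mul0r.
exists a', (kappa r1 * f ^+ k + b).
rewrite yE aE (u_top_const ur0) rmorph0 add0r mulrDl mulrDr exprS.
by rewrite (mulrC f a') !mulrA addrAC (addrC (_ + _)) addrA.
Qed.

(** Same induction on k, but no factor [u] hides the u-part of the digit of the cofactor, so both r0
    and r1 must vanish: multiplying by [u] isolates r0, and once r0 = 0 the relation itself isolates
    r1. *)
Lemma annihilator_expf k y : (k <= N)%N -> y * f ^+ (N - k) = 0 ->
  exists a, y = a * f ^+ k.
Proof.
elim: k => [|k IHk] in y * => [_ _|k_lt yf].
  by exists y; rewrite mulr1.
have Nk : (N - k = (N - k.+1).+1)%N by rewrite subnSK.
case: (IHk y) => [|| a yE]; first exact: ltnW.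
  by rewrite Nk exprSr mulrA yf mul0r.
have {yf} af : a * f ^+ N.-1 = 0.
  have -> : N.-1 = (k + (N - k.+1))%N.
    by rewrite -[in LHS](subnKC (ltnW k_lt)) Nk addnS.
  by rewrite -[RHS]yf yE exprD -mulrA.
have faf a' : f * a' * f ^+ N.-1 = 0.
  by rewrite mulrAC -exprS prednK ?nilpotency_index_gt0 // fN mul0r.
have [r0 [r1 [a' aE]]] := decomp a.
have r0_eq0 : r0 = 0.
  apply: u_top_const; have := congr1 ( *%R u) af.
  by rewrite mulr0 aE !mulrDl faf addr0 mulrDr !mulrA uu !mul0r addr0.
have r1_eq0 : r1 = 0.
  apply: u_top_const; move: af.
  by rewrite aE r0_eq0 rmorph0 add0r mulrDl faf addr0.
exists a'; rewrite yE aE r0_eq0 r1_eq0 rmorph0 mulr0 !add0r exprS.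
by rewrite (mulrC f) mulrA.
Qed.

Variables (i w : nat).
Hypotheses (w_le_i : (w <= i)%N) (i_le_N : (i <= N)%N).

(** The first relation gives y = a f^(N-i). The second then reads u a f^(N-(i-w)) = 0, so a = a'
    f^(i-w) + u b, and multiplying back by f^(N-i) gives the two terms. *)
Lemma annihilator_ideal y : f ^+ i * y = 0 -> u * f ^+ w * y = 0 ->
  exists a b, y = a * f ^+ (N - w) + b * (u * f ^+ (N - i)).
Proof.
rewrite -{1}(subKn i_le_N) mulrC => /annihilator_expf[|a ->].
  exact: leq_subr.
have NiE : (w + (N - i) = N - (i - w))%N.
  by rewrite addnC subnBA // addnBAC // addnC.
have NwE : (i - w + (N - i) = N - w)%N by rewrite addnBAC // subnKC.
rewrite mulrACA -exprD NiE.
move=> /annihilator_u_expf[|a' [b ->]]; first exact: leq_trans (leq_subr _ _) _.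
by exists a', b; rewrite mulrDl -mulrA -exprD NwE -!mulrA [u * _]mulrCA.
Qed.

(** If k < i, multiply the membership relation by u f^(N-1-k): the left side becomes the nonzero u
    f^(N-1), while the right side dies because i + (N-1-k) >= N and u^2 = 0. *)
Lemma expf_mem_ideal k :
  (exists a b, f ^+ k = a * f ^+ i + b * (u * f ^+ w)) -> (i <= k)%N.
Proof.
move=> [a [b fk]]; rewrite leqNgt; apply: contra u_top => k_lt.
have k_le : (k <= N.-1)%N.
  by rewrite -ltnS prednK ?nilpotency_index_gt0 ?(leq_trans k_lt).
have i_le : (N <= i + (N.-1 - k))%N.
  rewrite -{1}(prednK nilpotency_index_gt0) -{1}(subnKC k_le).
  by rewrite -addSn leq_add2r.
rewrite -(subnKC k_le) exprD fk mulrDl mulrDr -(mulrA a) -exprD expf_eq0 //.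
by rewrite !mulrA (mulrAC u b) uu !(mul0r, mulr0) addr0.
Qed.

Definition in_ideal y := exists a b, y = a * f ^+ i + b * (u * f ^+ w).
Definition annihilates y := f ^+ i * y = 0 /\ u * f ^+ w * y = 0.

(** Among the products of two generators, u f^(w+i) is the decisive one: u^2 = 0, and f^(2i)
    vanishes as soon as f^(w+i) does because w <= i. *)
Lemma ideal_annihilates :
  (forall y, in_ideal y -> annihilates y) <-> (N <= w + i)%N.
Proof.
split=> [/(_ (f ^+ i))[]|N_le _ [a [b ->]]].
- by exists 1, 0; rewrite mul1r mul0r addr0.
- by move=> _; rewrite -mulrA -exprD; apply: u_expf_eq0.
have ff : f ^+ i * f ^+ i = 0.
  by rewrite -exprD expf_eq0 // (leq_trans N_le) // leq_add2r.
have ff' : f ^+ w * f ^+ i = 0 by rewrite -exprD expf_eq0.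
split; rewrite mulrDr.
  by rewrite mulrCA ff mulr0 add0r mulrC -!mulrA ff' !mulr0.
rewrite mulrCA -(mulrA _ _ (f ^+ i)) ff' !mulr0 add0r.
by rewrite mulrCA mulrACA uu mul0r mulr0.
Qed.

Lemma ideal_eq_annihilator :
  (forall y, in_ideal y <-> annihilates y) <-> (w + i = N)%N.
Proof.
split=> [IE|wiN y].
  have N_le : (N <= w + i)%N by apply/ideal_annihilates => y /IE.
  have w_le_N : (w <= N)%N := leq_trans w_le_i i_le_N.
  apply/eqP; rewrite eqn_leq N_le andbT -(subnKC w_le_N) leq_add2l.
  (* The remaining bound is i <= N - w. The witness is f^(N-w): it annihilates u f^w since f^N = 0,
     and f^i since w <= i, so it belongs to the ideal. *)
  apply: expf_mem_ideal; apply/IE; split; last first.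
    by rewrite -mulrA -exprD subnKC // fN mulr0.
  by rewrite -exprD expf_eq0 // addnBCA ?leq_addr // addnC -addnBA ?leq_addr.
(* When w + i = N, the generators f^(N-w) and u f^(N-i) of the annihilator are f^i and u f^w. *)
split=> [|[fy uy]]; first by apply: (ideal_annihilates.2 _ y); rewrite wiN.
have [a [b ->]] := annihilator_ideal fy uy.
by exists a, b; rewrite -wiN addnK addKn.
Qed.

End TwoNilpotents.

(** * The quotient ring R[x]/(x^n - g) and its words *)

Section Ambient.

Variables (R : finComNzRingType) (n : nat) (g : R).
Hypothesis n_gt0 : (0 < n)%N.
Local Notation A := (ambient n g).

Lemma monic_modulus : 'X^n - g%:P \is monic.
Proof.
by rewrite monicE lead_coefDl ?lead_coefXn // size_polyN size_polyXn
           ltnS (leq_trans (size_polyC_leq1 _)).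
Qed.

Lemma size_modulus : size ('X^n - g%:P) = n.+1.
Proof.
by rewrite size_polyDl size_polyXn // size_polyN ltnS
           (leq_trans (size_polyC_leq1 _)).
Qed.

Lemma mk_monic_modulus : mk_monic ('X^n - g%:P) = 'X^n - g%:P.
Proof. by rewrite /mk_monic size_modulus monic_modulus ltnS n_gt0. Qed.

Lemma in_qpoly_modulus : in_qpoly ('X^n - g%:P) ('X^n - g%:P) = 0.
Proof.
apply: val_inj; rewrite /= mk_monic_modulus.
exact: Pdiv.RingMonic.rmodpp monic_modulus.
Qed.

Lemma in_qpolyC a : in_qpoly ('X^n - g%:P) a%:P = a%:A.
Proof. by rewrite -[a%:P]alg_polyC linearZ /= in_qpoly1. Qed.

Lemma in_qpolyXn k : in_qpoly ('X^n - g%:P) 'X^k = 'qX ^+ k.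
Proof. by rewrite rmorphXn. Qed.

Lemma qX_expn : 'qX ^+ n = g%:A :> A.
Proof.
have /eqP := in_qpoly_modulus.
by rewrite linearB /= in_qpolyXn in_qpolyC subr_eq0 => /eqP.
Qed.

Lemma coef_qX_exp k j : (k < n)%N -> ('qX ^+ k : A)`_j = (j == k)%:R.
Proof.
move=> k_lt; rewrite -in_qpolyXn in_qpoly_small ?coefXn //.
by rewrite mk_monic_modulus size_modulus size_polyXn ltnS.
Qed.

Lemma word_poly_sum c : word_poly g c = \sum_(i < n) c 0 i *: 'qX ^+ i.
Proof.
rewrite /word_poly {1}(row_sum_delta c) !linear_sum; apply: eq_bigr => i _.
by rewrite !linearZ /= rVpoly_delta in_qpolyXn.
Qed.

Lemma in_qpoly_val (y : A) : in_qpoly _ (y : {poly R}) = y.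
Proof. by apply: val_inj; apply: in_qpoly_small; apply: size_mk_monic. Qed.

Lemma word_poly_surj (y : A) : exists c, y = word_poly g c.
Proof.
exists (poly_rV (y : {poly R})); rewrite /word_poly poly_rV_K ?in_qpoly_val //.
apply: leq_trans (size_npoly y) _.
by rewrite mk_monic_modulus size_modulus.
Qed.

End Ambient.

(** * The semilinear map [star] and the sigma-dual as an annihilator *)

Section Star.

Variables (R : finComNzRingType) (n : nat) (g g' : R).
Variable sigma : {rmorphism R -> R}.
Hypotheses (n_gt0 : (0 < n)%N) (gg' : g * g' = 1) (sigma_g : sigma g = g').
Hypothesis sigma_inj : injective sigma.
Local Notation A := (ambient n g).

Definition qX_inv : A := g' *: 'qX ^+ n.-1.

Lemma mul_qX_inv : 'qX * qX_inv = 1.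
Proof.
by rewrite -scalerAr -exprS prednK // qX_expn // scalerA mulrC gg' scale1r.
Qed.

Lemma qX_inv_expn : qX_inv ^+ n = g'%:A.
Proof.
have /(congr1 ( *%R g'%:A)) : ('qX * qX_inv) ^+ n = 1.
  by rewrite mul_qX_inv expr1n.
by rewrite exprMn qX_expn // !mulr_algl scalerA (mulrC g') gg' scale1r.
Qed.

Lemma star_comm : commr_rmorph (in_alg A \o sigma) qX_inv.
Proof. by move=> a; exact: mulrC. Qed.

(** Applies sigma to the coefficients of the canonical representative and substitutes x^-1 for x;
    independence of the representative is [star_in_qpoly]. *)
Definition star (y : A) : A := horner_morph star_comm (y : {poly R}).

(** The substitution sends the modulus to x^-n - sigma(g) = g' - g' = 0, so reduction does not
    change the value. Multiplicativity of [star] follows from this. *)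
Lemma star_in_qpoly P : star (in_qpoly _ P) = horner_morph star_comm P.
Proof.
have h_monic := monic_modulus g n_gt0.
rewrite /star /= [in RHS](Pdiv.RingMonic.rdivp_eq h_monic P).
rewrite mk_monic_modulus // [in RHS]rmorphD rmorphM /= rmorphB /= rmorphXn /=.
rewrite horner_morphC horner_morphX.
by rewrite qX_inv_expn /= sigma_g subrr mulr0 add0r.
Qed.

Lemma starM y z : star (y * z) = star y * star z.
Proof.
rewrite -[in LHS](in_qpoly_val y) -[in LHS](in_qpoly_val z) -rmorphM.
by rewrite star_in_qpoly rmorphM.
Qed.

Lemma starZ a y : star (a *: y) = sigma a *: star y.
Proof. by rewrite /star linearZ /= mulr_algl. Qed.

Lemma star1 : star 1 = 1.
Proof.
by rewrite -[X in star X](in_qpoly1 ('X^n - g%:P)) star_in_qpoly rmorph1.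
Qed.

Lemma starXn y k : star (y ^+ k) = star y ^+ k.
Proof.
elim: k => [|k IHk]; last by rewrite !exprS starM IHk.
exact: star1.
Qed.

Lemma starB y z : star (y - z) = star y - star z.
Proof. exact: rmorphB. Qed.

Lemma star_qX : star 'qX = qX_inv.
Proof. by rewrite star_in_qpoly horner_morphX. Qed.

Lemma mul_star_qX : 'qX * star 'qX = 1.
Proof. by rewrite star_qX mul_qX_inv. Qed.

Lemma star_linear_factor c : c * sigma c = 1 ->
  star (c *: 'qX - 1) = - (sigma c *: star 'qX) * (c *: 'qX - 1).
Proof.
move=> cc; rewrite starB starZ star1 mulNr mulrBr mulr1 opprB.
rewrite -scalerAl -scalerAr (mulrC (star _)) mul_star_qX.
by rewrite scalerA (mulrC (sigma c)) cc scale1r.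
Qed.

(** The product is x^(i-j). For i >= j it is a monomial of degree below n, with a constant term only
    when i = j. *)
Lemma coef0_qX_inv (i j : 'I_n) :
  ('qX ^+ i * qX_inv ^+ j)`_0 = (i == j)%:R.
Proof.
have [le_ji|lt_ij] := leqP j i.
  rewrite -(subnK le_ji) exprD -mulrA -exprMn mul_qX_inv expr1n mulr1.
  rewrite coef_qX_exp // ?(leq_ltn_trans (leq_subr _ _)) // eq_sym subn_eq0.
  by rewrite -val_eqE eqn_leq le_ji andbT.
have le_in : (j - i <= n)%N by rewrite (leq_trans (leq_subr _ _)) // ltnW.
rewrite -{1}(subnK (ltnW lt_ij)) addnC exprD mulrA -exprMn mul_qX_inv.
rewrite expr1n mul1r.
(* A negative exponent is wrapped around by x^-n = g'; since i < j < n, the new exponent lies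
   strictly between 0 and n, so there is no constant term. *)
have -> : qX_inv ^+ (j - i) = g' *: 'qX ^+ (n - (j - i)).
  rewrite -[LHS]mul1r -(expr1n _ (n - (j - i))) -mul_qX_inv exprMn -mulrA.
  by rewrite -exprD subnK // qX_inv_expn mulr_algr.
rewrite coefZ coef_qX_exp //; last by rewrite ltn_subrL subn_gt0 lt_ij.
rewrite -val_eqE (ltn_eqF lt_ij) eq_sym subn_eq0 leqNgt.
by rewrite (leq_ltn_trans (leq_subr _ _)) // mulr0.
Qed.

Lemma star_word x :
  star (word_poly g x) = \sum_(j < n) sigma (x 0 j) *: qX_inv ^+ j.
Proof.
rewrite star_in_qpoly {1}(row_sum_delta x) !raddf_sum; apply: eq_bigr => j _.
rewrite /= linearZ /= rVpoly_delta linearZ /= rmorphXn /= horner_morphX.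
by rewrite mulr_algl.
Qed.

Lemma coef0_word_star c x :
  (word_poly g c * star (word_poly g x))`_0 =
  \sum_(i < n) c 0 i * sigma (x 0 i).
Proof.
rewrite word_poly_sum // star_word mulr_suml poly_of_qpoly_sum coef_sum.
apply: eq_bigr => i _; rewrite mulr_sumr poly_of_qpoly_sum coef_sum.
under eq_bigr do
  rewrite -scalerAl -scalerAr !poly_of_qpolyZ !coefZ coef0_qX_inv.
rewrite (bigD1 i) // big1 => [|j ji].
  by rewrite /= eqxx mulr1 addr0.
by rewrite eq_sym (negPf ji) !mulr0.
Qed.

(** Pairing with the i-th unit word reads off sigma(x_i), and sigma is injective. *)
Lemma star_eq0 y : star y = 0 -> y = 0.
Proof.
have [x ->] := word_poly_surj n_gt0 y => x0.
suff -> : x = 0 by rewrite /word_poly !raddf0.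
apply/rowP => i; apply: sigma_inj; rewrite mxE rmorph0.
have := coef0_word_star (delta_mx 0 i) x.
rewrite x0 mulr0 coef0 (bigD1 i) //= big1 => [|j ji].
  by rewrite mxE !eqxx mul1r addr0.
by rewrite mxE (negPf ji) andbF mul0r.
Qed.

(** Here star(y z) is the unit [v] times y star(z), and [star] has trivial kernel. This removes
    [star] from the annihilator conditions. *)
Lemma mul_star_eq0 y v v' z : v' * v = 1 -> star y = v * y ->
  y * star z = 0 <-> y * z = 0.
Proof.
move=> v'v yE; have yzE : star (y * z) = v * (y * star z).
  by rewrite starM yE mulrA.
split=> [yz|yz]; first by apply: star_eq0; rewrite yzE yz mulr0.
by rewrite -[LHS]mul1r -v'v -mulrA -yzE yz /star !raddf0 mulr0.
Qed.

(** Orthogonality only controls constant terms. As an ideal is stable under multiplication by x^-i,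
    the constant terms of all y x^-i star(x) vanish as well, and these are the coefficients of y
    star(x). *)
Lemma mem_sigma_dual (C : {set 'rV[R]_n}) (gs : seq A) x :
  ideal_of_code C (ideal_gen gs) ->
  x \in sigma_dual sigma C <->
  (forall y, ideal_gen gs y -> y * star (word_poly g x) = 0).
Proof.
move=> CI; rewrite inE; split=> [/forall_inP xC y Iy|xC]; last first.
  apply/forall_inP => c /CI /xC cx.
  by rewrite -coef0_word_star cx coef0.
have [d dE] := word_poly_surj n_gt0 (y * star (word_poly g x)).
rewrite dE; suff -> : d = 0 by rewrite /word_poly !raddf0.
apply/rowP => i; rewrite mxE.
have <- : (word_poly g d * star (word_poly g (delta_mx 0 i)))`_0 = d 0 i.
  rewrite coef0_word_star (bigD1 i) // big1 => [|j ji] /=.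
    by rewrite mxE !eqxx rmorph1 mulr1 addr0.
  by rewrite mxE (negPf ji) andbF rmorph0 mulr0.
rewrite -dE mulrAC.
have [c cE] := word_poly_surj n_gt0 (y * star (word_poly g (delta_mx 0 i))).
rewrite cE coef0_word_star; apply/eqP/xC/CI; rewrite -cE mulrC.
exact: ideal_gen_mull.
Qed.

End Star.

(** * The elements [u] and [f] over the dual numbers *)

Section DualNumberAmbient.

Variables (F : finFieldType) (n : nat) (g : dualnum F) (c : F).
Hypotheses (n_gt0 : (0 < n)%N) (c_neq0 : c != 0).
Local Notation A := (ambient n g).
Local Notation f := (dn_const c *: 'qX - 1 : A).
Local Notation kappa := (in_alg A \o qpolyC ('X^2 : {poly F})).

Lemma dn_u_neq0 : dn_u F != 0.
Proof.
apply/eqP => /(congr1 val) /= /eqP.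
rewrite mk_monic_Xn Pdiv.CommonRing.rmodp_small ?polyX_eq0 //.
by rewrite size_polyX size_polyXn.
Qed.

Lemma dn_constK (a : F) : a != 0 -> dn_const a * dn_const a^-1 = 1.
Proof. by move=> a_neq0; rewrite /dn_const -qpolyCM divff. Qed.

(** Exhibits [f] as a unit times a monic linear polynomial, to which the factor theorem and degree
    counts apply. *)
Lemma linear_factor :
  f = in_qpoly _ (dn_const c *: ('X - (dn_const c^-1)%:P)).
Proof.
rewrite linearZ linearB /= in_qpolyC scalerBr scalerA dn_constK //.
by rewrite scale1r.
Qed.

Lemma ambient_decomp (b : A) : exists r0 r1 b',
  b = kappa r0 + (dn_u F)%:A * kappa r1 + f * b'.
Proof.
(* Division by x - a leaves the remainder B(a), a dual number whose two coordinates are the digits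
   r0 and r1. *)
pose B := polyn b; pose a := dn_const c^-1.
have /factor_theorem [q BE] : root (B - B.[a]%:P) a.
  by rewrite rootE !hornerE subrr.
exists (B.[a]`_0), (B.[a]`_1), (in_qpoly _ (dn_const c^-1 *: q)).
have -> : f * in_qpoly _ (dn_const c^-1 *: q) = b - B.[a]%:A.
  rewrite linear_factor -rmorphM /= -scalerAl -scalerAr scalerA dn_constK //.
  by rewrite scale1r mulrC -BE linearB /= in_qpoly_val in_qpolyC.
have -> : kappa B.[a]`_0 + (dn_u F)%:A * kappa B.[a]`_1 = B.[a]%:A.
  by rewrite mulr_algl scalerA -scalerDl -dn_decomp.
by rewrite [RHS]addrC subrK.
Qed.

(** The element is u c^(n-1) (x - c^-1)^(n-1), of degree below n and hence its own remainder; its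
    coefficient at x^(n-1) is [u] times a unit. *)
Lemma u_expf_top : (dn_u F)%:A * f ^+ n.-1 != 0.
Proof.
rewrite linear_factor -rmorphXn mulr_algl -linearZ exprZn scalerA.
apply/eqP => /(congr1 (fun y : A => y`_n.-1)).
set q := ('X - _) ^+ _.
have sz_q : size q = n by rewrite size_exp_XsubC prednK.
rewrite in_qpoly_small; last first.
  rewrite mk_monic_modulus // size_modulus // ltnS.
  by rewrite (leq_trans (size_scale_leq _ _)) ?sz_q.
have q_monic : q \is monic by rewrite monic_exp ?monicXsubC.
have q_top : q`_n.-1 = 1 by rewrite -(monicP q_monic) lead_coefE sz_q.
rewrite coef0 coefZ q_top mulr1 => a0.
have /eqP[] := dn_u_neq0; have := congr1 ( *%R^~ (dn_const c^-1 ^+ n.-1)) a0.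
by rewrite mul0r -mulrA -exprMn dn_constK // expr1n mulr1.
Qed.

End DualNumberAmbient.

(** * Self-orthogonality and self-duality of the code *)

Theorem theorem4p8 (p m s : nat) (F : finFieldType)
    (p_prime : prime p) (p_odd : odd p) (m_gt0 : (0 < m)%N) (s_gt0 : (0 < s)%N)
    (cardF : #|F| = (p ^ m)%N)
    (theta : {rmorphism F -> F}) (theta_bij : bijective theta)
    (eps : F) (eps_neq0 : eps != 0)
    (sigma : {rmorphism dualnum F -> dualnum F})
    (sigmaK : cancel sigma (Theta theta eps))
    (ThetaK : cancel (Theta theta eps) sigma)
    (gamma gamma0 : F) (gamma_neq0 : gamma != 0)
    (gamma0E : gamma0 ^+ (p ^ s)%N = gamma^-1)
    (gamma0_theta : gamma0 = theta gamma0^-1)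
    (i omega T : nat)
    (f : ambient (p ^ s)%N (dn_const gamma))
    (fE : f = dn_const gamma0 *: 'qX - 1)
    (i_gt0 : (1 <= i)%N) (i_le : (i <= p ^ s - 1)%N)
    (T_in : ideal_gen [:: f ^+ i] (dn_u F *: f ^+ T))
    (T_min : forall t : nat, ideal_gen [:: f ^+ i] (dn_u F *: f ^+ t) -> (T <= t)%N)
    (omega_lt : (omega < T)%N)
    (C : {set 'rV[dualnum F]_(p ^ s)%N})
    (C_constacyclic : constacyclic (dn_const gamma) C)
    (C_ideal : ideal_of_code (g := dn_const gamma) C
                 (ideal_gen [:: f ^+ i; dn_u F *: f ^+ omega])) :
  (sigma_self_orthogonal sigma C <-> (p ^ s <= omega + i)%N) /\
  (sigma_self_dual sigma C <-> (omega + i = p ^ s)%N).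
Proof.
set N := (p ^ s)%N in f fE gamma0E i_le T_in T_min C C_constacyclic C_ideal *.
have N_gt0 : (0 < N)%N by rewrite expn_gt0 prime_gt0.
have i_leN : (i <= N)%N by rewrite (leq_trans i_le) // leq_subr.
have gamma0_neq0 : gamma0 != 0.
  apply: contraNneq gamma_neq0 => g0.
  by rewrite -[gamma]invrK -gamma0E g0 expr0n (gtn_eqF N_gt0) invr0.
pose u : ambient N (dn_const gamma) := (dn_u F)%:A.
have uE k : dn_u F *: f ^+ k = u * f ^+ k by rewrite mulr_algl.
have uu : u * u = 0 by rewrite mulr_algl scalerA dn_uu scale0r.
(* By Frobenius, f^N = gamma0^N x^N - 1 = gamma^-1 gamma - 1. *)
have fN : f ^+ N = 0.
  have pA : p \in [pchar ambient N (dn_const gamma)].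
    by rewrite !pchar_qpoly (card_finPcharP cardF).
  have NA : [pchar ambient N (dn_const gamma)].-nat N.
    by rewrite pnatX pnatE ?pA.
  rewrite fE exprDn_pchar // exprNn_pchar // expr1n exprZn qX_expn //.
  rewrite scalerA -rmorphXn -rmorphM /= gamma0E mulVf // rmorph1 scale1r.
  exact: subrr.
have decomp := @ambient_decomp F N (dn_const gamma) gamma0 gamma0_neq0.
have u_top := @u_expf_top F N (dn_const gamma) gamma0 N_gt0 gamma0_neq0.
rewrite -fE -/u in decomp u_top.
(* Since u f^i lies in the ideal generated by f^i, minimality gives T <= i. *)
have omega_i : (omega < i)%N.
  apply: (leq_trans omega_lt); apply: T_min.
  by exists (fun=> u); rewrite big_ord1 uE.
have theta_gamma0 : theta gamma0 = gamma0^-1.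
  by rewrite [in RHS]gamma0_theta fmorphV invrK.
have sigma_const a : sigma (dn_const (theta a)) = dn_const a.
  have := ThetaK (dn_const a + dn_u F * dn_const 0).
  by rewrite ThetaE rmorph0 /dn_const rmorph0 !mulr0 !addr0.
(* Taking N-th powers in theta(gamma0) = gamma0^-1 gives theta(gamma^-1) = gamma, which sigma
   undoes. *)
have sigma_gamma : sigma (dn_const gamma) = dn_const gamma^-1.
  rewrite -[RHS]sigma_const -gamma0E rmorphXn /= theta_gamma0 exprVn gamma0E.
  by rewrite invrK.
have sigma_gamma0 : sigma (dn_const gamma0) = dn_const gamma0^-1.
  by rewrite {1}gamma0_theta sigma_const.
have [r r_neq0 sigma_u] :
    exists2 r, r != 0 & sigma (dn_u F) = dn_u F * dn_const r.
  have [theta' theta'K thetaK] := theta_bij.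
  (* Chosen so that [Theta] maps u r to u eps theta(r) = u; applying sigma gives sigma(u) = u r. *)
  exists (theta' eps^-1).
    apply: contra_neq (invr_neq0 eps_neq0) => /(congr1 theta).
    by rewrite thetaK rmorph0.
  have := ThetaK (dn_const 0 + dn_u F * dn_const (theta' eps^-1)).
  by rewrite ThetaE rmorph0 thetaK dn_constK // mulr1 /dn_const rmorph0 !add0r.
have sigma_inj : injective sigma := can_inj sigmaK.
have gg' := dn_constK gamma_neq0.
pose st := star (n := N) (g := dn_const gamma) (dn_const gamma^-1) sigma.
pose wp := word_poly (n := N) (dn_const gamma).
have x_stx : 'qX * st 'qX = 1 by exact: mul_star_qX.
(* The unit with star(f) = v f, coming from [star_linear_factor]; [v'] is its inverse, as x inverts
   star(x). *)
pose v := - (dn_const gamma0^-1 *: st 'qX).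
pose v' : ambient N (dn_const gamma) := - (dn_const gamma0 *: 'qX).
have v'v : v' * v = 1.
  rewrite /v /v' mulrNN -scalerAl -scalerAr x_stx scalerA dn_constK //.
  by rewrite scale1r.
have st_f : st f = v * f.
  rewrite fE /v -sigma_gamma0; apply: star_linear_factor => //.
  by rewrite sigma_gamma0 dn_constK.
have st_u : st u = (dn_const r)%:A * u.
  by rewrite /st starZ star1 // sigma_u mulr_algl scalerA mulrC.
have r'r :
    (dn_const r^-1)%:A * (dn_const r)%:A = 1 :> ambient N (dn_const gamma).
  by rewrite mulr_algl scalerA mulrC dn_constK // scale1r.
have st_fX k : st (f ^+ k) = v ^+ k * f ^+ k.
  by rewrite /st starXn // -exprMn -st_f.
have memC c : c \in C <-> in_ideal u f i omega (wp c).
  by apply: (iff_trans (C_ideal c)); rewrite uE; apply: ideal_gen2P.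
have wp_surj y : exists c, y = wp c := word_poly_surj N_gt0 y.
have ann x : x \in sigma_dual sigma C <-> annihilates u f i omega (wp x).
  have fi_eq0 : f ^+ i * st (wp x) = 0 <-> f ^+ i * wp x = 0.
    apply: (mul_star_eq0 (v := v ^+ i) (v' := v' ^+ i)
             N_gt0 gg' sigma_gamma sigma_inj); last exact: st_fX.
    by rewrite -exprMn v'v expr1n.
  have uf_eq0 : u * f ^+ omega * st (wp x) = 0 <-> u * f ^+ omega * wp x = 0.
    apply: (mul_star_eq0 (v := (dn_const r)%:A * v ^+ omega)
             (v' := (dn_const r^-1)%:A * v' ^+ omega)
             N_gt0 gg' sigma_gamma sigma_inj).
      by rewrite mulrACA r'r mul1r -exprMn v'v expr1n.
    by rewrite starM // [X in X * _]st_u [X in _ * X]st_fX mulrACA.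
  apply: (iff_trans (mem_sigma_dual N_gt0 gg' sigma_gamma x C_ideal)).
  rewrite uE; apply: iff_trans (and_iff_compat_l _ uf_eq0).
  apply: iff_trans (and_iff_compat_r _ fi_eq0).
  split=> [Ix|[fx ux] y /ideal_gen2P[a [b ->]]].
    split; apply: Ix; apply/ideal_gen2P.
      by exists 1, 0; rewrite mul1r mul0r addr0.
    by exists 0, 1; rewrite mul1r mul0r add0r.
  rewrite mulrDl -!(mulrA a) -!(mulrA b).
  by rewrite [f ^+ i * _]fx [_ * star _ _ _]ux !mulr0 addr0.
have [selfann eqann] := (ideal_annihilates uu fN u_top (ltnW omega_i),
  ideal_eq_annihilator uu fN u_top decomp (ltnW omega_i) i_leN).
split.
  apply: iff_trans selfann; split=> [/subsetP CC y Iy|IA].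
    by have [c cE] := wp_surj y; rewrite cE in Iy *; apply/ann/CC/memC.
  by apply/subsetP => c /memC/IA/ann.
apply: iff_trans eqann; split=> [CE y|IE].
  have [c ->] := wp_surj y; split=> [/memC|/ann]; first by rewrite CE => /ann.
  by rewrite -CE => /memC.
by apply/setP => c; apply/idP/idP => [/memC/IE/ann|/ann/IE/memC].
Qed.
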